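(* Let $\{(x_t,v_t)\}_{t\ge0}$ be generated by ESOM-$K$ (defined in the context) with parameters $\alpha>0$, $\epsilon>0$ and integer $K\ge 0$. Suppose that each $f_i$ is twice differentiable with $mI\preceq\nabla^2 f_i(y)\preceq MI$ for all $y\in\mathbb{R}^p$, $i=1,\dots,n$, where $0<m\le M<\infty$, and that $\|\nabla^2 f(x)-\nabla^2 f(\tilde x)\|\le L\|x-\tilde x\|$ for all $x,\tilde x\in\mathbb{R}^{np}$. Let $c>0$ be a lower bound for the local weights, $w_{ii}\ge c$ for all $i$, and define $$\rho:=\frac{2\alpha(1-c)}{2\alpha(1-c)+m+\epsilon},\qquad \Gamma_t:=\min\Big\{2M,\frac{L}{2}\|x_{t+1}-x_t\|\Big\}+\big(M+\epsilon+2\alpha(1-c)\big)\rho^{K+1}.$$ Let $\beta>1$ and $\phi>1$ be arbitrary constants, let $t\ge0$, and let $\zeta$ be a positive constant with $$\zeta\in\Big(\frac{m+M}{2mM},\ \frac{\epsilon}{\Gamma_t^2}\Big).$$ Let $\hat\lambda_{\min}(I-Z)$ be the smallest non-zero eigenvalue of $I-Z$. Then $$\|u_{t+1}-u^*\|_G^2\ \le\ \frac{1}{1+\delta_t'}\,\|u_t-u^*\|_G^2,$$ where $$\delta_t'=\min\left\{\frac{2\alpha\hat\lambda_{\min}(I-Z)}{\phi\beta(m+M)},\ \ \frac{2mM}{\epsilon(m+M)}-\frac{1}{\zeta\epsilon},\ \ \frac{(\beta-1)\alpha\hat\lambda_{\min}(I-Z)}{\beta\epsilon}\Big[1-\fr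ac{\zeta\Gamma_t^2}{\epsilon}\Big]\Big[1+\frac{\phi\Gamma_t^2(\beta-1)}{(\phi-1)\epsilon^2}\Big]^{-1}\right\}.$$
   Context: Setting. A connected undirected network has $n\ge 2$ nodes; $\mathcal{N}_i$ denotes the set of neighbors of node $i$. Node $i$ has a local function $f_i:\mathbb{R}^p\to\mathbb{R}$. For $x=[x_1;\dots;x_n]\in\mathbb{R}^{np}$ with $x_i\in\mathbb{R}^p$, put $f(x)=\sum_{i=1}^n f_i(x_i)$. The weight matrix $W\in\mathbb{R}^{n\times n}$ has entries $w_{ij}\ge 0$ with $w_{ij}=0$ if and only if $j\notin\mathcal{N}_i\cup\{i\}$, and satisfies $W^T=W$, $W\mathbf{1}=\mathbf{1}$, $\mathrm{null}(I-W)=\mathrm{span}(\mathbf{1})$. Put $Z:=W\otimes I_p\in\mathbb{R}^{np\times np}$, and let $Z_d:=\mathrm{diag}(Z)$ be the diagonal matrix with the diagonal of $Z$; $I-Z$ is positive semidefinite and $(I-Z)^{1/2}$ is its positive semidefinite square root. ESOM-$K$. Given $(x_t,v_t)$, set $D_t:=\nabla^2 f(x_t)+\epsilon I+2\alpha(I-Z_d)$, $B:=\alpha(I-2Z_d+Z)$ and $$\tilde H_t^{-1}(K):=D_t^{-1/2}\sum_{u=0}^K\big(D_t^{-1/2}BD_t^{-1/2}\big)^uD_t^{-1/2}.$$ The updates are $$x_{t+1}=x_t-\tilde H_t^{-1}(K)\big[\nabla f(x_t)+(I-Z)^{1/2}v_t+\alpha(I-Z)x_t\big],\qquad v_{t+1}=v_t+\alpha(I-Z)^{1/2}x_{t+1}.$$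 Optimal points. $x^*$ is the solution of $\min_{x\in\mathbb{R}^{np}} f(x)$ subject to $(I-Z)^{1/2}x=0$, and $v^*$ is an optimal dual variable, i.e. $\nabla f(x^* )+(I-Z)^{1/2}v^*=0$, chosen in the column space of $(I-Z)^{1/2}$. The initial dual variable $v_0$ lies in the column space of $(I-Z)^{1/2}$ (e.g. $v_0=0$), so that all $v_t$ do. Notation. $u_t=[v_t;x_t]\in\mathbb{R}^{2np}$, $u^*=[v^*;x^*]$, $G=\begin{bmatrix} I&0\\0&\alpha\epsilon I\end{bmatrix}\in\mathbb{R}^{2np\times 2np}$, $\|u\|_G^2=u^TGu$; thus $\|u_t-u^*\|_G^2=\|v_t-v^*\|^2+\alpha\epsilon\|x_t-x^*\|^2$. $\|\cdot\|$ is the Euclidean norm for vectors and the induced (spectral) norm for matrices. *)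

(* Defs.v *)
From HB Require Import structures.
From mathcomp Require Export all_boot all_order all_algebra.
From mathcomp Require Export mxtens.
From mathcomp Require Export all_classical all_reals all_analysis.

Set Implicit Arguments.
Unset Strict Implicit.
Unset Printing Implicit Defensive.

Export Order.TTheory GRing.Theory Num.Theory.
Export numFieldNormedType.Exports.

Local Open Scope classical_set_scope.
Local Open Scope ring_scope.

Definition enorm (R : realType) (k : nat) (x : 'cV[R]_k) : R :=
  Num.sqrt (\sum_(i < k) x i 0 ^+ 2).

Definition opnorm (R : realType) (k : nat) (A : 'M[R]_k) : R :=
  sup [set enorm (A *m x) | x in [set x : 'cV[R]_k | enorm x <= 1]].

Definition psd (R : realType) (k : nat) (A : 'M[R]_k) : Prop :=
  A^T = A /\ forall x : 'cV[R]_k, 0 <= (x^T *m A *m x) 0 0.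

Definition loewner_le (R : realType) (k : nat) (A B : 'M[R]_k) : Prop :=
  psd (B - A).

(* A positive semidefinite matrix has exactly one positive semidefinite square
   root; the default value 0 is returned when A is not positive semidefinite. *)
Definition sqrtmx (R : realType) (k : nat) (A : 'M[R]_k) : 'M[R]_k :=
  xget 0 [set S : 'M[R]_k | psd S /\ S *m S = A].

Definition diag_part (R : realType) (k : nat) (A : 'M[R]_k) : 'M[R]_k :=
  diag_mx (\row_i A i i).

Definition is_min_nonzero_eigenvalue (R : realType) (k : nat) (A : 'M[R]_k)
    (lam : R) : Prop :=
  [/\ eigenvalue A lam, lam != 0 &
      forall mu : R, eigenvalue A mu -> mu != 0 -> lam <= mu].

Definition grad (R : realType) (k : nat) (F : 'cV[R]_k -> R) (x : 'cV[R]_k) :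
    'cV[R]_k :=
  \col_i 'D_(delta_mx i 0) F x.

Definition hess (R : realType) (k : nat) (F : 'cV[R]_k -> R) (x : 'cV[R]_k) :
    'M[R]_k :=
  \matrix_(i, j) 'D_(delta_mx j 0) (fun y => grad F y i 0) x.

Definition twice_differentiable (R : realType) (k : nat) (F : 'cV[R]_k -> R) :
    Prop :=
  forall y : 'cV[R]_k, differentiable F y /\ differentiable (grad F) y.

(* Block x_i of x = [x_1; ...; x_n]; mxtens_index is also the indexing of the
   Kronecker product *t, so that W *t 1%:M acts blockwise. *)
Definition blk (R : realType) (n p : nat) (x : 'cV[R]_(n * p)) (i : 'I_n) :
    'cV[R]_p :=
  \col_j x (mxtens_index (i, j)) 0.

Definition aggregate (R : realType) (n p : nat) (f : 'I_n -> 'cV[R]_p -> R)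
    (x : 'cV[R]_(n * p)) : R :=
  \sum_(i < n) f i (blk x i).

Definition Zmx (R : realType) (n p : nat) (W : 'M[R]_n) : 'M[R]_(n * p) :=
  W *t (1%:M : 'M[R]_p).

(* For a connected simple graph e, the neighbours of i are the j with e i j. *)
Definition connected_graph (n : nat) (e : rel 'I_n) : Prop :=
  [/\ symmetric e, irreflexive e & forall i j : 'I_n, connect e i j].

Definition weight_matrix (R : realType) (n : nat) (e : rel 'I_n)
    (W : 'M[R]_n) : Prop :=
  [/\ forall i j : 'I_n, 0 <= W i j,
      forall i j : 'I_n, W i j = 0 <-> ~~ (e i j || (j == i)),
      W^T = W,
      W *m (const_mx 1 : 'cV[R]_n) = const_mx 1 &
      forall y : 'cV[R]_n,
        (1%:M - W) *m y = 0 <-> exists a : R, y = a *: const_mx 1].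

Definition esomD (R : realType) (n p : nat) (W : 'M[R]_n)
    (f : 'I_n -> 'cV[R]_p -> R) (alpha eps : R) (x : 'cV[R]_(n * p)) :
    'M[R]_(n * p) :=
  hess (aggregate f) x + eps%:M
    + (2 * alpha) *: (1%:M - diag_part (Zmx p W)).

Definition esomB (R : realType) (n p : nat) (W : 'M[R]_n) (alpha : R) :
    'M[R]_(n * p) :=
  alpha *: (1%:M - 2 *: diag_part (Zmx p W) + Zmx p W).

Definition esomHinv (R : realType) (n p : nat) (W : 'M[R]_n)
    (f : 'I_n -> 'cV[R]_p -> R) (alpha eps : R) (K : nat)
    (x : 'cV[R]_(n * p)) : 'M[R]_(n * p) :=
  let Dmh := invmx (sqrtmx (esomD W f alpha eps x)) in
  Dmh *m (\sum_(u < K.+1) (Dmh *m esomB p W alpha *m Dmh) ^+ u) *m Dmh.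

Definition esom_seq (R : realType) (n p : nat) (W : 'M[R]_n)
    (f : 'I_n -> 'cV[R]_p -> R) (alpha eps : R) (K : nat)
    (x v : nat -> 'cV[R]_(n * p)) : Prop :=
  let S := sqrtmx (1%:M - Zmx p W) in
  forall t : nat,
    x t.+1 = x t - esomHinv W f alpha eps K (x t) *m
      (grad (aggregate f) (x t) + S *m v t
       + alpha *: ((1%:M - Zmx p W) *m x t))
    /\ v t.+1 = v t + alpha *: (S *m x t.+1).

Definition primal_solution (R : realType) (n p : nat) (W : 'M[R]_n)
    (f : 'I_n -> 'cV[R]_p -> R) (xs : 'cV[R]_(n * p)) : Prop :=
  let S := sqrtmx (1%:M - Zmx p W) in
  S *m xs = 0 /\
  forall y : 'cV[R]_(n * p), S *m y = 0 -> aggregate f xs <= aggregate f y.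

Definition in_colspace (R : realType) (k : nat) (A : 'M[R]_k) (y : 'cV[R]_k) :
    Prop :=
  exists w : 'cV[R]_k, y = A *m w.

Definition Gmx (R : realType) (k : nat) (alpha eps : R) : 'M[R]_(k + k) :=
  block_mx 1%:M 0 0 (alpha * eps)%:M.

Definition sqnormG (R : realType) (k : nat) (G : 'M[R]_k) (u : 'cV[R]_k) : R :=
  (u^T *m G *m u) 0 0.

Definition esom_rho (R : realType) (alpha eps m c : R) : R :=
  (2 * alpha * (1 - c)) / (2 * alpha * (1 - c) + m + eps).

Definition esom_Gamma (R : realType) (alpha eps m M L c : R) (K k : nat)
    (xt xt1 : 'cV[R]_k) : R :=
  Num.min (2 * M) (L / 2 * enorm (xt1 - xt))
  + (M + eps + 2 * alpha * (1 - c)) * esom_rho alpha eps m c ^+ K.+1.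

Definition esom_delta (R : realType)
    (alpha eps m M beta phi zeta Gamma lam : R) : R :=
  Num.min (2 * alpha * lam / (phi * beta * (m + M)))
    (Num.min (2 * m * M / (eps * (m + M)) - 1 / (zeta * eps))
       ((beta - 1) * alpha * lam / (beta * eps)
        * (1 - zeta * Gamma ^+ 2 / eps)
        * (1 + phi * Gamma ^+ 2 * (beta - 1) / ((phi - 1) * eps ^+ 2))^-1)).

(* Main.v *)
(* Write (xs, vs) for the optimal pair, x' = x_{t+1}, v' = v_{t+1},
   d = x' - x_t, S = (I - Z)^{1/2} and q = grad f(x') - grad f(xs).  Since v' = v_t + alpha S x', the primal update
   is an inexact proximal step
     q + S (v' - vs) + eps d + e = 0,
   where e collects the Taylor remainder of grad f along d and the residual of
   the truncated Neumann series for the Newton system.  As 0 <= B <= rho D, the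
   latter is at most (M + eps + 2 alpha (1 - c)) rho^{K+1} |d|, and so
   |e| <= Gamma_t |d|.  Pairing the equation with x' - xs and using
   cocoercivity of grad f bounds |u_t - us|_G^2 - |u' - us|_G^2 from below by a
   combination of |x' - xs|^2, |q|^2 and |d|^2.  The missing dual term
   |v' - vs|^2 is controlled by |S (v' - vs)|^2 / lambda, because v' - vs lies
   in the column space of S, and hence, by the equation again, by |q|^2 and
   |d|^2. *)
Require Import Defs.
From mathcomp Require Import all_boot all_order all_algebra.
From mathcomp Require Import mxtens.
From mathcomp Require Import all_classical all_reals all_analysis.
From mathcomp Require Import complex spectral ring lra.

Set Implicit Arguments.
Unset Strict Implicit.
Unset Printing Implicit Defensive.

Import Order.TTheory GRing.Theory Num.Theory.
Import numFieldNormedType.Exports.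
Local Open Scope ring_scope.

(** * Inner product and positive semidefinite matrices *)

Definition dot (R : realType) (k : nat) (x y : 'cV[R]_k) : R := (x^T *m y) 0 0.

Lemma dot_mulmxl (R : realType) (k l : nat) (A : 'M[R]_(k, l)) x y :
  dot (A *m x) y = dot x (A^T *m y).
Proof. by rewrite /dot trmx_mul mulmxA. Qed.

Section Dot.
Variables (R : realType) (k : nat).
Implicit Types (x y z : 'cV[R]_k) (A : 'M[R]_k) (a r : R).

Lemma dotE x y : dot x y = \sum_i x i 0 * y i 0.
Proof. by rewrite /dot mxE; apply: eq_bigr => i _; rewrite mxE. Qed.

Lemma dotC x y : dot x y = dot y x.
Proof. by rewrite !dotE; apply: eq_bigr => i _; rewrite mulrC. Qed.

Lemma dotDr x y z : dot x (y + z) = dot x y + dot x z.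
Proof. by rewrite /dot mulmxDr mxE. Qed.

Lemma dotZr a x y : dot x (a *: y) = a * dot x y.
Proof. by rewrite /dot -scalemxAr mxE. Qed.

Lemma dotNr x y : dot x (- y) = - dot x y.
Proof. by rewrite -scaleN1r dotZr mulN1r. Qed.

Lemma dotDl x y z : dot (x + y) z = dot x z + dot y z.
Proof. by rewrite dotC dotDr !(dotC z). Qed.

Lemma dotZl a x y : dot (a *: x) y = a * dot x y.
Proof. by rewrite dotC dotZr dotC. Qed.

Lemma dotNl x y : dot (- x) y = - dot x y.
Proof. by rewrite dotC dotNr dotC. Qed.

Definition dot_lin := (dotDr, dotDl, dotNr, dotNl, dotZr, dotZl).

Lemma dot_delta x i : dot x (delta_mx i 0) = x i 0.
Proof.
rewrite dotE (bigD1 i) //= mxE !eqxx mulr1 big1 ?addr0 // => j /negbTE ji.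
by rewrite mxE ji mulr0.
Qed.

Lemma dot_ge0 x : 0 <= dot x x.
Proof. by rewrite dotE sumr_ge0 // => i _; rewrite -expr2 sqr_ge0. Qed.

Lemma dot_eq0 x : dot x x = 0 -> x = 0.
Proof.
rewrite dotE => /psumr_eq0P h; apply/matrixP => i j; rewrite ord1 mxE.
have /eqP := h (fun i _ => sqr_ge0 (x i 0)) i isT.
by rewrite mulf_eq0 orbb => /eqP.
Qed.

Lemma dot_sym A x y : A^T = A -> dot (A *m x) y = dot x (A *m y).
Proof. by move=> hA; rewrite dot_mulmxl hA. Qed.

Lemma enorm_ge0 x : 0 <= enorm x.
Proof. exact: sqrtr_ge0. Qed.

Lemma sqr_enorm x : enorm x ^+ 2 = dot x x.
Proof.
rewrite /enorm sqr_sqrtr ?dotE; last by apply: sumr_ge0 => i _; exact: sqr_ge0.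
by apply: eq_bigr => i _; rewrite expr2.
Qed.

Lemma enormZ a x : 0 <= a -> enorm (a *: x) = a * enorm x.
Proof.
have enormE y : enorm y = Num.sqrt (dot y y).
  by rewrite -sqr_enorm sqrtr_sqr ger0_norm ?enorm_ge0.
move=> a0; rewrite !enormE !dot_lin mulrA -expr2 sqrtrM ?sqr_ge0 //.
by rewrite sqrtr_sqr ger0_norm.
Qed.

Lemma enorm_le x y a : 0 <= a -> dot x x <= a ^+ 2 * dot y y ->
  enorm x <= a * enorm y.
Proof.
move=> a0 h; rewrite -ler_sqr ?nnegrE ?mulr_ge0 ?enorm_ge0 //.
by rewrite exprMn !sqr_enorm.
Qed.

Lemma psdP A : psd A <-> A^T = A /\ forall x, 0 <= dot x (A *m x).
Proof.
by split=> -[h1 h2]; split=> // x; have := h2 x; rewrite /dot mulmxA.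
Qed.

Lemma psd_sym A : psd A -> A^T = A.
Proof. by case. Qed.

Lemma psd_ge0 A x : psd A -> 0 <= dot x (A *m x).
Proof. by move=> /psdP[]. Qed.

(** The form of [A] is nonnegative on the span of [x] and [y]; evaluating it at coefficients built
    from its own entries exposes the discriminant. *)
Lemma psd_cauchy_schwarz A x y : psd A ->
  dot x (A *m y) ^+ 2 <= dot x (A *m x) * dot y (A *m y).
Proof.
move=> pA; have sA := psd_sym pA.
have q s t : 0 <= dot x (A *m x) * s ^+ 2 + dot x (A *m y) * (s * t) *+ 2
    + dot y (A *m y) * t ^+ 2.
  have := psd_ge0 (s *: x + t *: y) pA.
  rewrite mulmxDr -!scalemxAr !dot_lin [dot y (A *m x)]dotC dot_sym //.
  by congr (0 <= _); ring.
move: (dot x (A *m x)) (dot x (A *m y)) (dot y (A *m y)) q => a b c q.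
have a0 : 0 <= a by have := q 1 0; lra.
have c0 : 0 <= c by have := q 0 1; lra.
move: c0; rewrite le_eqVlt => /orP[/eqP c0|c0].
  (* If both diagonal entries vanish, the value at [(1, - b)] is [- 2 b ^ 2], which forces
     [b = 0]. *)
  move: a0; rewrite le_eqVlt => /orP[/eqP a0|a0].
    by have := q 1 (- b); rewrite -c0 -a0; nra.
  have := q (- b) a.
  have -> : a * (- b) ^+ 2 + b * (- b * a) *+ 2 + c * a ^+ 2
    = a * (a * c - b ^+ 2) by ring.
  by rewrite pmulr_rge0 // subr_ge0.
have := q c (- b).
have -> : a * c ^+ 2 + b * (c * - b) *+ 2 + c * (- b) ^+ 2
  = c * (a * c - b ^+ 2) by ring.
by rewrite pmulr_rge0 // subr_ge0.
Qed.

Lemma psd1 : psd (1%:M : 'M[R]_k).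
Proof. by apply/psdP; rewrite trmx1; split=> // x; rewrite mul1mx dot_ge0. Qed.

Lemma cauchy_schwarz x y : dot x y <= enorm x * enorm y.
Proof.
have [xy0|xy0] := leP (dot x y) 0.
  by rewrite (le_trans xy0) // mulr_ge0 ?enorm_ge0.
rewrite -ler_sqr ?nnegrE ?mulr_ge0 ?enorm_ge0 ?(ltW xy0) // exprMn !sqr_enorm.
by have := psd_cauchy_schwarz x y psd1; rewrite !mul1mx.
Qed.

Lemma enorm_triangle x y : enorm (x + y) <= enorm x + enorm y.
Proof.
rewrite -ler_sqr ?nnegrE ?addr_ge0 ?enorm_ge0 // sqrrD !sqr_enorm !dot_lin.
by have := cauchy_schwarz x y; rewrite [dot y x]dotC; lra.
Qed.

Lemma enormN x : enorm (- x) = enorm x.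
Proof.
by rewrite /enorm; congr Num.sqrt; apply: eq_bigr => i _; rewrite mxE sqrrN.
Qed.

Lemma coercive_unitmx A r : 0 < r ->
  (forall z, r * dot z z <= dot z (A *m z)) -> A \in unitmx.
Proof.
move=> r0 hA; rewrite -row_free_unit; apply: inj_row_free => w wA.
have := hA w^T; rewrite {2}/dot trmxK mulmxA wA mul0mx mxE.
rewrite pmulr_rle0 // => h; apply: trmx_inj; rewrite trmx0; apply: dot_eq0.
by apply/le_anti; rewrite h dot_ge0.
Qed.

Lemma psd_eigenvalue_ge0 A a : psd A -> eigenvalue A a -> 0 <= a.
Proof.
move=> pA /eigenvalueP[w wA w0].
have := psd_ge0 w^T pA; rewrite /dot trmxK mulmxA wA -scalemxAl mxE.
rewrite -{1}[w]trmxK -/(dot _ _) pmulr_lge0 // lt_def dot_ge0 andbT.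
by apply: contra_neq w0 => /dot_eq0 h; apply: trmx_inj; rewrite h trmx0.
Qed.

(** Cauchy-Schwarz for the form of [A], applied to [A y] and [y], gives [|A y|^4 <= <A y, A (A y)>
    <y, A y> <= r |A y|^2 <y, A y>]; then [|A y|^2] is divided out. *)
Lemma psd_le_image A r y : psd A -> 0 <= r ->
  (forall z, dot z (A *m z) <= r * dot z z) ->
  dot (A *m y) (A *m y) <= r * dot y (A *m y).
Proof.
move=> pA r0 hA; have sA := psd_sym pA.
have := psd_cauchy_schwarz (A *m y) y pA.
have := hA (A *m y); have := psd_ge0 y pA; have := dot_ge0 (A *m y).
move: (dot (A *m y) (A *m y)) (dot y (A *m y)) (dot _ _) => a b d.
rewrite le_eqVlt => /orP[/eqP <- b0 _ _|a0 b0 dr h]; first exact: mulr_ge0.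
rewrite -(ler_pM2l a0) -expr2 (le_trans h) //.
by rewrite mulrCA [leRHS]mulrA ler_wpM2r.
Qed.

Lemma psd_sqnorm_le A r y : psd A -> 0 <= r ->
  (forall z, dot z (A *m z) <= r * dot z z) ->
  dot (A *m y) (A *m y) <= r ^+ 2 * dot y y.
Proof.
move=> pA r0 hA; apply: (le_trans (psd_le_image y pA r0 hA)).
by rewrite expr2 -mulrA ler_wpM2l.
Qed.

(** The shift [A + r I] is positive semidefinite with form at most [2 r]; expanding [psd_le_image]
    for it cancels the cross terms. *)
Lemma sym_sqnorm_le A r y : A^T = A -> 0 <= r ->
  (forall z, - (r * dot z z) <= dot z (A *m z) <= r * dot z z) ->
  dot (A *m y) (A *m y) <= r ^+ 2 * dot y y.
Proof.
move=> sA r0 hA.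
have AE z : (A + r%:M) *m z = A *m z + r *: z by rewrite mulmxDl mul_scalar_mx.
have pA : psd (A + r%:M).
  apply/psdP; split=> [|z]; first by rewrite linearD /= tr_scalar_mx sA.
  by rewrite AE !dot_lin; have := hA z; lra.
have /= := @psd_le_image _ (r *+ 2) y pA.
rewrite !AE mulrn_wge0 // => /(_ isT) h.
have {h} := h _; rewrite !dot_lin [dot (A *m y) y]dotC => h.
suff: forall z, dot z ((A + r%:M) *m z) <= r *+ 2 * dot z z by move=> /h; lra.
by move=> z; rewrite AE !dot_lin; have := hA z; lra.
Qed.

End Dot.

(** * Spectral theorem and square roots *)

Section Spectral.
Variable R : realType.

(** Over the complex numbers an eigenvector exists; its real or its imaginary part, whichever is
    nonzero, is a real eigenvector. *)
Lemma sym_eigenvector (k : nat) (A : 'M[R]_k.+1) : A^T = A ->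
  exists (a : R) (u : 'cV[R]_k.+1), u != 0 /\ A *m u = a *: u.
Proof.
move=> sA.
pose AC : 'M[R[i]]_k.+1 := map_mx (real_complex R) A.
have [c /eigenvalueP[w wA w0]] := eigenvalue_closed AC (ltn0Sn k).
pose x : 'cV[R]_k.+1 := \col_j complex.Re (w 0 j).
pose y : 'cV[R]_k.+1 := \col_j complex.Im (w 0 j).
have ReD (z t : R[i]) : complex.Re (z + t) = complex.Re z + complex.Re t.
  by case: z; case: t.
have ImD (z t : R[i]) : complex.Im (z + t) = complex.Im z + complex.Im t.
  by case: z; case: t.
have Ax : A *m x = complex.Re c *: x - complex.Im c *: y.
  apply/colP => j; move/rowP: wA => /(_ j).
  rewrite !mxE => /(congr1 (@complex.Re R)).
  rewrite (big_morph _ ReD (erefl : complex.Re (0 : R[i]) = 0)) => h.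
  transitivity (complex.Re (c * w 0 j)); last first.
    by case: (c) => ? ?; case: (w 0 j) => ? ? /=; ring.
  rewrite -h.
  apply: eq_bigr => l _; rewrite !mxE -[in LHS]sA !mxE.
  by case: (w 0 l) => a b /=; ring.
have Ay : A *m y = complex.Im c *: x + complex.Re c *: y.
  apply/colP => j; move/rowP: wA => /(_ j).
  rewrite !mxE => /(congr1 (@complex.Im R)).
  rewrite (big_morph _ ImD (erefl : complex.Im (0 : R[i]) = 0)) => h.
  transitivity (complex.Im (c * w 0 j)); last first.
    by case: (c) => ? ?; case: (w 0 j) => ? ? /=; ring.
  rewrite -h.
  apply: eq_bigr => l _; rewrite !mxE -[in LHS]sA !mxE.
  by case: (w 0 l) => a b /=; ring.
have [x0|x0] := eqVneq x 0; last first.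
  exists (complex.Re c), x; split=> //; rewrite Ax.
  (* Comparing [<A x, y>] with [<x, A y>] leaves [Im c * (|x|^2 + |y|^2) = 0]. *)
  suff -> : complex.Im c = 0 by rewrite scale0r subr0.
  have := dot_sym x y sA; rewrite Ax Ay !dot_lin.
  have : 0 < dot x x.
    by rewrite lt_def dot_ge0 andbT; apply: contra_neq x0; exact: dot_eq0.
  by have := dot_ge0 y; move: (dot x x) (dot y y) (dot x y) => *; nra.
have y0 : y != 0.
  apply: contra_neq w0 => y0; apply/rowP => j; rewrite mxE.
  move/colP: x0 => /(_ j); move/colP: y0 => /(_ j); rewrite !mxE.
  by case: (w 0 j) => a b /= -> ->.
by exists (complex.Re c), y; split=> //; rewrite Ay x0 scaler0 add0r.
Qed.

(* The Householder reflection exchanging [e_0] and [u]. *)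
Lemma orthogonal_completion (k : nat) (u : 'cV[R]_k.+1) : dot u u = 1 ->
  exists Q : 'M[R]_k.+1, Q^T *m Q = 1%:M /\ Q *m delta_mx 0 0 = u.
Proof.
move=> u1; pose e : 'cV[R]_k.+1 := delta_mx 0 0; pose w := u - e.
have [w0|w0] := eqVneq w 0.
  exists 1%:M; rewrite trmx1 !mul1mx; split=> //.
  by apply/esym/eqP; rewrite -subr_eq0 -/e -/w w0.
have ee : dot e e = 1 by rewrite dot_delta mxE !eqxx.
have ww : dot w w = 2 - 2 * dot u e.
  by rewrite /w !dot_lin u1 ee [dot e u]dotC; ring.
have ww0 : dot w w != 0 by apply: contra_neq w0; exact: dot_eq0.
pose Q : 'M[R]_k.+1 := 1%:M - (2 / dot w w) *: (w *m w^T).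
have QE z : Q *m z = z - (2 / dot w w * dot w z) *: w.
  rewrite mulmxBl mul1mx -scalemxAl -mulmxA [w^T *m z]mx11_scalar.
  by rewrite mul_mx_scalar scalerA.
have QT : Q^T = Q.
  by rewrite /Q linearB /= linearZ /= trmx1 trmx_mul trmxK.
exists Q; split.
  have MM : w *m w^T *m (w *m w^T) = dot w w *: (w *m w^T).
    by rewrite mulmxA -(mulmxA w) [w^T *m w]mx11_scalar mul_mx_scalar scalemxAl.
  rewrite QT /Q mulmxBl mul1mx mulmxBr mulmx1 -scalemxAl -scalemxAr MM.
  rewrite opprB !scalerA (_ : _ * dot w w = 2 / dot w w + 2 / dot w w).
    by rewrite scalerDl addrK subrK.
  by field.
(* Since [|w|^2 = 2 - 2 <u, e>] and [<w, e> = <u, e> - 1], the coefficient is -1 and [e] is sent to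
   [e + w = u]. *)
rewrite -/e QE (_ : _ * _ = - 1); last first.
  rewrite (_ : dot w e = dot u e - 1); last by rewrite /w !dot_lin ee.
  by move: ww0; rewrite ww => h; field.
by rewrite scaleN1r opprK /w addrC subrK.
Qed.

(** Induction on the size: conjugating by an orthogonal matrix whose first column is a unit
    eigenvector splits off a 1 by 1 block, and the symmetric remainder is diagonalized by
    induction. *)
Lemma spectral_theorem (k : nat) (A : 'M[R]_k) : A^T = A ->
  exists (P : 'M[R]_k) (d : 'rV[R]_k),
    P^T *m P = 1%:M /\ A = P *m diag_mx d *m P^T.
Proof.
elim: k A => [|k IH] A sA.
  by exists 0, 0; split; apply/matrixP => -[].
have [a [u0 [u00 Au0]]] := sym_eigenvector sA.
have nu0 : 0 < dot u0 u0.
  by rewrite lt_def dot_ge0 andbT; apply: contra_neq u00; exact: dot_eq0.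
pose u := (Num.sqrt (dot u0 u0))^-1 *: u0.
have uu : dot u u = 1.
  rewrite !dot_lin mulrA -invfM -expr2 sqr_sqrtr ?ltW // mulVf ?gt_eqF //.
have Au : A *m u = a *: u by rewrite -scalemxAr Au0 !scalerA mulrC.
have [Q [QQ Qe]] := orthogonal_completion uu.
have QQ' : Q *m Q^T = 1%:M by apply: mulmx1C.
pose B : 'M[R]_(1 + k) := Q^T *m A *m Q.
have sB : B^T = B by rewrite /B !trmx_mul trmxK sA mulmxA.
have Be : Q^T *m A *m Q *m delta_mx 0 0 = a *: delta_mx 0 0 :> 'cV_k.+1.
  rewrite -!mulmxA Qe Au -Qe -scalemxAr; congr (_ *: _).
  by rewrite mulmxA QQ mul1mx.
have B0 j : B j 0 = a * (j == 0)%:R.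
  by move/colP: Be => /(_ j); rewrite -colE mxE => ->; rewrite !mxE andbT.
have AE : A = Q *m B *m Q^T.
  by rewrite /B !mulmxA QQ' mul1mx -mulmxA QQ' mulmx1.
clearbody B.
have Bul : ulsubmx B = a%:M.
  by apply/matrixP => i j; rewrite !ord1 !mxE lshift0 B0 eqxx mulr1.
have Bdl : dlsubmx B = 0.
  by apply/matrixP => i j; rewrite !ord1 !mxE lshift0 B0 mulr0.
have Bur : ursubmx B = 0.
  by rewrite -[ursubmx B]trmxK trmx_ursub sB Bdl trmx0.
have [|P [d [PP PE]]] := IH (drsubmx B).
  by rewrite trmx_drsub sB.
pose P1 : 'M[R]_(1 + k) := block_mx 1%:M 0 0 P.
have PP1 : P1^T *m P1 = 1%:M.
  rewrite /P1 tr_block_mx mulmx_block !trmx0 !mul0mx !mulmx0 trmx1 mul1mx PP.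
  by rewrite !addr0 !add0r -scalar_mx_block.
have BE : B = P1 *m diag_mx (row_mx a%:M d) *m P1^T.
  rewrite -[LHS]submxK Bul Bur Bdl PE diag_mx_row /P1 tr_block_mx.
  rewrite !mulmx_block !trmx0 !mul0mx !mulmx0 trmx1 mul1mx.
  rewrite !addr0 !add0r ?mul0mx ?mulmx1 ?mulmx0; congr block_mx.
  by apply/matrixP => i j; rewrite !ord1 !mxE.
exists (Q *m P1), (row_mx a%:M d); split.
  by rewrite trmx_mul -mulmxA (mulmxA Q^T) QQ mul1mx PP1.
rewrite trmx_mul !mulmxA -[Q *m P1 *m _]mulmxA -[Q *m _ *m _]mulmxA -BE.
exact: AE.
Qed.

Lemma dot_diag (k : nat) (d : 'rV[R]_k) (x y : 'cV[R]_k) :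
  dot x (diag_mx d *m y) = \sum_i d 0 i * (x i 0 * y i 0).
Proof.
by rewrite dotE; apply: eq_bigr => i _; rewrite mul_diag_mx mxE; ring.
Qed.

(** The default value in [sqrtmx] is excluded by exhibiting a root: take square roots of the
    eigenvalues in an orthonormal eigenbasis. *)
Lemma psd_sqrtmx (k : nat) (A : 'M[R]_k) : psd A ->
  psd (sqrtmx A) /\ sqrtmx A *m sqrtmx A = A.
Proof.
move=> pA; rewrite /sqrtmx; case: xgetP => [S _ //|/= noS].
have [P [d [PP AE]]] := spectral_theorem (psd_sym pA).
(* The eigenvalue [d 0 i] is the value of the form of [A] at column [i] of [P]. *)
have d0 i : 0 <= d 0 i.
  have := psd_ge0 (P *m delta_mx i 0) pA.
  rewrite dot_mulmxl AE !mulmxA PP mul1mx -mulmxA -mulmxA [P^T *m _]mulmxA PP.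
  rewrite mul1mx dot_diag (bigD1 i) //= big1 => [|j /negbTE ji].
    by rewrite !mxE !eqxx !mulr1 addr0.
  by rewrite !mxE ji !(mul0r, mulr0).
pose r : 'rV[R]_k := \row_i Num.sqrt (d 0 i).
case: (noS (P *m diag_mx r *m P^T)); split.
  apply/psdP; split; first by rewrite !trmx_mul trmxK tr_diag_mx mulmxA.
  move=> x; rewrite -!mulmxA -[P]trmxK -dot_mulmxl trmxK dot_diag.
  rewrite sumr_ge0 // => i _.
  by rewrite mulr_ge0 ?mxE ?sqrtr_ge0 // -expr2 sqr_ge0.
rewrite !mulmxA -[_ *m P^T *m P]mulmxA PP mulmx1 AE; congr (_ *m _).
rewrite -mulmxA; congr (_ *m _); rewrite mulmx_diag; congr diag_mx.
by apply/rowP => i; rewrite !mxE -expr2 sqr_sqrtr.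
Qed.

(** In an eigenbasis of [S], the vector [w = S y] has coordinates [s_i z_i]. Those with [s_i = 0]
    vanish; for the others [s_i ^ 2] is a nonzero eigenvalue of [A], hence at least [lam]. *)
Lemma sqrt_colspace_bound (k : nat) (A S : 'M[R]_k) (lam : R) (w : 'cV[R]_k) :
  psd S -> S *m S = A -> is_min_nonzero_eigenvalue A lam -> in_colspace S w ->
  lam * dot w w <= dot (S *m w) (S *m w).
Proof.
move=> pS SS [_ _ lamP] [y ->]; have sS := psd_sym pS.
have [P [s [PP SE]]] := spectral_theorem sS.
have PSE x : P^T *m (S *m x) = diag_mx s *m (P^T *m x).
  by rewrite SE !mulmxA PP mul1mx.
have dotP x z : dot (P^T *m x) (P^T *m z) = dot x z.
  by rewrite dot_mulmxl trmxK mulmxA (mulmx1C PP) mul1mx.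
rewrite -[dot (S *m y) _]dotP -[leRHS]dotP !PSE; move: (P^T *m y) => z.
rewrite !dotE mulr_sumr; apply: ler_sum => i _; rewrite !mul_diag_mx !mxE.
have [->|si0] := eqVneq (s 0 i) 0; first by rewrite !(mul0r, mulr0).
have : lam <= s 0 i ^+ 2.
  apply: lamP; last by rewrite expf_neq0.
  apply/eigenvalueP; exists (row i P^T); last first.
    apply/negP => /eqP h; have := congr1 (mulmx^~ P) h.
    rewrite -row_mul PP mul0mx => /rowP/(_ i); rewrite !mxE eqxx => /eqP.
    by rewrite oner_eq0.
  rewrite -SS mulmxA -!row_mul {1}SE !mulmxA PP mul1mx.
  have -> : diag_mx s *m P^T *m S = diag_mx s *m diag_mx s *m P^T.
    by rewrite {1}SE !mulmxA -[_ *m P^T *m P]mulmxA PP mulmx1.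
  rewrite mulmx_diag; apply/rowP => j.
  by rewrite mxE mul_diag_mx !mxE expr2.
have := sqr_ge0 (s 0 i * z i 0); move: (z i 0) (s 0 i) => a b h1 h2.
have : 0 <= (b ^+ 2 - lam) * (b * a) ^+ 2 by rewrite mulr_ge0 // subr_ge0.
by congr (is_true _); rewrite -[RHS]subr_ge0; congr (0 <= _); ring.
Qed.

End Spectral.

(** * Gradients and Hessians *)

Section Calculus.
Variable R : realType.
Implicit Types k l : nat.

Lemma cV_sum_delta k (x : 'cV[R]_k) : x = \sum_i x i 0 *: delta_mx i 0.
Proof.
apply/colP => i; rewrite summxE (bigD1 i) //= big1 => [|j /negbTE ij].
  by rewrite !mxE !eqxx mulr1 addr0.
by rewrite !mxE eq_sym ij mulr0.
Qed.

Lemma eq_mulmx_cV k l (A B : 'M[R]_(k, l)) :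
  (forall x : 'cV[R]_l, A *m x = B *m x) -> A = B.
Proof.
move=> AB; apply/matrixP => i j.
by have /colP/(_ i) := AB (delta_mx j 0); rewrite -!colE !mxE.
Qed.

Lemma mulmx_continuous k l (A : 'M[R]_(k, l)) :
  continuous (mulmx A : 'cV[R]_l -> 'cV[R]_k).
Proof.
move=> x; apply: differentiable_continuous.
have -> : mulmx A = \sum_j ((fun y => y j 0 *: col j A) : 'cV[R]_l -> 'cV[R]_k).
  apply/funext => y; rewrite fct_sumE [y in LHS]cV_sum_delta mulmx_sumr.
  by apply: eq_bigr => j _; rewrite -scalemxAr colE.
apply: differentiable_sum => j; apply: differentiableZl.
exact: differentiable_coord.
Qed.

Lemma differentiable_mulmx k l (A : 'M[R]_(k, l)) (x : 'cV[R]_l) :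
  differentiable (mulmx A : 'cV[R]_l -> 'cV[R]_k) x.
Proof. exact/linear_differentiable/mulmx_continuous. Qed.

Lemma diff_mulmx k l (A : 'M[R]_(k, l)) (x : 'cV[R]_l) :
  'd (mulmx A : 'cV[R]_l -> 'cV[R]_k) x = mulmx A :> (_ -> _).
Proof. exact/diff_lin/mulmx_continuous. Qed.

Lemma diff_dot_grad k (F : 'cV[R]_k -> R) x d :
  differentiable F x -> 'd F x d = dot (grad F x) d.
Proof.
move=> dF; rewrite [d in LHS]cV_sum_delta linear_sum dotE.
by apply: eq_bigr => i _; rewrite linearZ /= mxE deriveE // mulrC.
Qed.

Lemma diff_grad_hess k (F : 'cV[R]_k -> R) x d :
  differentiable (grad F) x -> 'd (grad F) x d = hess F x *m d.
Proof.
move=> dF; rewrite [d in LHS]cV_sum_delta linear_sum; apply/colP => i.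
rewrite summxE mxE; apply: eq_bigr => j _; rewrite linearZ /= !mxE -deriveE //.
by rewrite derive_mx ?mxE 1?mulrC //; exact: diff_derivable.
Qed.

(** The scalar mean value theorem for [<w, grad F (y + s d)> - b s ^ 2] on [[0, 1]]. The quadratic
    correction serves to recover the factor 1/2 in the second-order Taylor bound; elsewhere
    [b = 0]. *)
Lemma mean_value_grad k (F : 'cV[R]_k -> R) (w y d : 'cV[R]_k) (b : R) :
  (forall x, differentiable (grad F) x) ->
  exists2 s, 0 < s < 1 & dot w (grad F (y + d) - grad F y) - b
    = dot w (hess F (y + s *: d) *m d) - 2 * b * s.
Proof.
move=> dF.
pose g (s : R) := y + s *: d.
have dg s : is_diff s g ( *:%R^~ d).
  have -> : g = cst y + *:%R^~ d by apply/funext.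
  rewrite -[*:%R^~ d in X in is_diff _ _ X]add0r.
  exact: (is_diffD (is_diff_cst y s) (is_diff_scalel s d)).
pose M := grad F \o g.
have dM s : differentiable M s by exact: differentiable_comp.
have dM1 s : derivable M s 1 by exact: diff_derivable.
have M1 s : 'D_1 M s = hess F (g s) *m d.
  by rewrite deriveE // diff_comp //= diff_val scale1r diff_grad_hess.
pose phi (s : R) := dot w (M s) - b * s ^+ 2.
have phiE :
    phi = \sum_i w i 0 \*: (fun s => M s i 0) - b \*: (@GRing.exp R ^~ 2).
  by apply/funext => s; rewrite /phi !fctE fct_sumE dotE.
have dphi s : is_derive (s : R) (1 : R) phi
    (dot w (hess F (g s) *m d) - 2 * b * s).
  have dMi i : is_derive (s : R) (1 : R) (fun s => M s i 0)
      ((hess F (g s) *m d) i 0).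
    rewrite -M1 derive_mx // mxE.
    by apply/derivableP; have /derivable_mxP := dM1 s; exact.
  rewrite phiE; apply: is_derive_eq; rewrite dotE; congr (_ - _).
  by rewrite /= /GRing.scale /=; ring.
have [s s01 h] : exists2 s, s \in `]0, 1[ & phi 1 - phi 0 =
    (dot w (hess F (g s) *m d) - 2 * b * s) * (1 - 0).
  apply: MVT => //; apply: continuous_subspaceT => s.
  by apply/differentiable_continuous/derivable1_diffP; have [] := dphi s.
exists s; first by move: s01; rewrite in_itv.
move: h; rewrite /phi /M /= /g scale1r scale0r addr0 dotDr dotNr => h.
by rewrite -[RHS]/(dot w (hess F (g s) *m d) - 2 * b * s); lra.
Qed.

(** * Functions with Hessian between [m I] and [M I] *)

Section Bounded.
Variables (k : nat) (F : 'cV[R]_k -> R) (m M : R).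
Hypothesis dF : forall x, differentiable (grad F) x.
Hypotheses (m0 : 0 < m) (mM : m <= M).
Hypotheses (hm : forall y, loewner_le m%:M (hess F y)).
Hypotheses (hM : forall y, loewner_le (hess F y) M%:M).

Lemma hess_sym y : (hess F y)^T = hess F y.
Proof.
have := psd_sym (hm y); rewrite linearB /= tr_scalar_mx.
by move/(can_inj (subrK _)).
Qed.

Lemma hess_ge y z : m * dot z z <= dot z (hess F y *m z).
Proof.
have := psd_ge0 z (hm y).
by rewrite mulmxBl mul_scalar_mx !dot_lin subr_ge0.
Qed.

Lemma hess_le y z : dot z (hess F y *m z) <= M * dot z z.
Proof.
have := psd_ge0 z (hM y).
by rewrite mulmxBl mul_scalar_mx !dot_lin subr_ge0.
Qed.

(** Taking [w = r] gives [|r|^2 <= <r, u> <= c |r|]. The vector [u] may depend on [w], as the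
    intermediate point of the mean value theorem does. *)
Lemma enorm_le_mean (r : 'cV[R]_k) (c : R) : 0 <= c ->
  (forall w, exists2 u, dot w r <= dot w u & enorm u <= c) -> enorm r <= c.
Proof.
move=> c0 /(_ r)[u hr hu].
have : enorm r ^+ 2 <= enorm r * c.
  rewrite sqr_enorm (le_trans hr) // (le_trans (cauchy_schwarz _ _)) //.
  by rewrite ler_wpM2l ?enorm_ge0.
have := enorm_ge0 r; rewrite le_eqVlt => /orP[/eqP <- //|r0].
by rewrite expr2 ler_pM2l.
Qed.

(* Along the segment the mean value theorem, paired with the vector being
   bounded, replaces the integral form of the increment of the gradient. *)
Lemma cocoercive y d q : q = grad F (y + d) - grad F y ->
  m * M * dot d d + dot q q <= (m + M) * dot d q.
Proof.
move=> qE.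
(* Centring the Hessian at [(m + M) / 2] leaves a symmetric matrix of norm at most [(M - m) / 2];
   the squared bound on [q - (m + M) / 2 d] rearranges to the claim. *)
have := @enorm_le_mean (q - ((m + M) / 2) *: d) ((M - m) / 2 * enorm d).
rewrite mulr_ge0 ?enorm_ge0 ?divr_ge0 ?subr_ge0 // => /(_ isT) h.
have {h}/h : forall w, exists2 u,
    dot w (q - ((m + M) / 2) *: d) <= dot w u &
    enorm u <= (M - m) / 2 * enorm d.
  move=> w; have [s _] := mean_value_grad w y d 0 dF.
  rewrite subr0 mulr0 mul0r subr0 -qE => hs.
  move: (hess_sym (y + s *: d)) (hess_ge (y + s *: d)).
  move: (hess_le (y + s *: d)) hs.
  move: (hess F _) => H MH hs sH mH.
  exists ((H - ((m + M) / 2)%:M) *m d).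
    by rewrite mulmxBl mul_scalar_mx !dot_lin hs.
  apply: enorm_le; first by rewrite divr_ge0 ?subr_ge0.
  apply: sym_sqnorm_le; first by rewrite linearB /= tr_scalar_mx sH.
    by rewrite divr_ge0 ?subr_ge0.
  move=> z; rewrite mulmxBl mul_scalar_mx !dot_lin.
  by have := MH z; have := mH z; move: (dot z z) (dot z _) => a b; lra.
rewrite -ler_sqr ?nnegrE ?mulr_ge0 ?enorm_ge0 ?divr_ge0 ?subr_ge0 //.
rewrite exprMn !sqr_enorm !dot_lin [dot q d]dotC.
by move: (dot d d) (dot q q) (dot d q) => a b c; nra.
Qed.

Lemma enorm_hess_sub_le y y' z :
  enorm ((hess F y' - hess F y) *m z) <= 2 * M * enorm z.
Proof.
have M0 : 0 <= M by exact: le_trans (ltW m0) mM.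
move: (hess_sym y') (hess_ge y') (hess_le y').
move: (hess_sym y) (hess_ge y) (hess_le y).
move: (hess F _) (hess F _) => H' H sH mH MH sH' mH' MH'.
apply: enorm_le; first by rewrite mulr_ge0.
apply: sym_sqnorm_le; first by rewrite linearB /= sH sH'.
  by rewrite mulr_ge0.
move=> u; rewrite mulmxBl !dot_lin.
have := MH u; have := mH u; have := MH' u; have := mH' u.
have := mulr_ge0 (ltW m0) (dot_ge0 u); have := mulr_ge0 M0 (dot_ge0 u).
by move: (dot u u) (dot u _) (dot u _) => a b c; lra.
Qed.

Lemma taylor_grad_le y d :
  enorm (grad F (y + d) - grad F y - hess F y *m d) <= 2 * M * enorm d.
Proof.
have M0 : 0 <= M by exact: le_trans (ltW m0) mM.
apply: enorm_le_mean; first by rewrite mulr_ge0 ?enorm_ge0 ?mulr_ge0.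
move=> w; have [s _] := mean_value_grad w y d 0 dF.
rewrite subr0 mulr0 mul0r subr0 => h.
exists ((hess F (y + s *: d) - hess F y) *m d); last exact: enorm_hess_sub_le.
by rewrite mulmxBl dotDr h -dotDr.
Qed.

(** The remainder [r] is paired with itself, with [b = L / 2 |d|^2 |r|]: the Lipschitz bound
    [L s |d|^2 |r|] at the intermediate point is then exactly [2 b s], so [|r|^2 <= b]. *)
Lemma taylor_grad_lipschitz (L : R) y d :
  (forall y z u,
    enorm ((hess F y - hess F z) *m u) <= L * enorm (y - z) * enorm u) ->
  enorm (grad F (y + d) - grad F y - hess F y *m d) <= L / 2 * enorm d ^+ 2.
Proof.
move=> hL; set r := grad _ _ - _ - _.
have := enorm_ge0 r; rewrite le_eqVlt => /orP[/eqP <-|r0].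
  (* No sign of [L] is assumed; [0 <= L |d|^2] is read off from [hL] at [y + d] and [y]. *)
  have e1 : y + d - y = d by rewrite addrAC subrr add0r.
  have := le_trans (enorm_ge0 _) (hL (y + d) y d).
  by rewrite e1 -mulrA -expr2 mulrAC => h; rewrite divr_ge0.
have [s /andP[s0 s1]] :=
  mean_value_grad r y d (L / 2 * enorm d ^+ 2 * enorm r) dF.
have arith (a b c p q : R) :
    a - L / 2 * q ^+ 2 * p = c - 2 * (L / 2 * q ^+ 2 * p) * s ->
    c - b <= L * q ^+ 2 * p * s -> a - b <= p * (L / 2 * q ^+ 2) by lra.
have hs : dot r ((hess F (y + s *: d) - hess F y) *m d)
    <= L * enorm d ^+ 2 * enorm r * s.
  apply: le_trans (cauchy_schwarz _ _) _.
  have e1 : y + s *: d - y = s *: d by rewrite addrAC subrr add0r.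
  apply: le_trans (ler_wpM2l (ltW r0) (hL (y + s *: d) y d)) _.
  by rewrite e1 (enormZ _ (ltW s0)) le_eqVlt; apply/orP; left; apply/eqP; ring.
move=> h; have : enorm r * enorm r <= enorm r * (L / 2 * enorm d ^+ 2).
  have -> : enorm r * enorm r
      = dot r (grad F (y + d) - grad F y) - dot r (hess F y *m d).
    by rewrite -expr2 sqr_enorm -dotNr -dotDr.
  have {hs} : dot r (hess F (y + s *: d) *m d) - dot r (hess F y *m d)
      <= L * enorm d ^+ 2 * enorm r * s by rewrite -dotNr -dotDr -mulmxBl.
  exact: arith h.
by rewrite ler_pM2l.
Qed.

End Bounded.

(** The bound [c] makes the set in [opnorm] bounded above, so that its [sup] is a genuine supremum
    and not a default value; the rest is homogeneity. *)
Lemma opnorm_ge k (A : 'M[R]_k) (c : R) : 0 <= c ->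
  (forall z, enorm (A *m z) <= c * enorm z) ->
  forall z, enorm (A *m z) <= opnorm A * enorm z.
Proof.
move=> c0 hA z.
have := enorm_ge0 z; rewrite le_eqVlt => /orP[/eqP z0|z0].
  by have := hA z; rewrite -z0 !mulr0.
rewrite -ler_pdivrMr // mulrC -enormZ ?invr_ge0 ?enorm_ge0 // scalemxAr.
apply: ub_le_sup.
  exists c => _ [u /= u1 <-]; apply: le_trans (hA u) _.
  by rewrite -[leRHS]mulr1 ler_wpM2l.
exists ((enorm z)^-1 *: z) => //=.
by rewrite enormZ ?invr_ge0 ?enorm_ge0 // mulVf ?gt_eqF.
Qed.

(** * Derivatives of sums of functions composed with linear maps *)

Section Aggregate.
Variables (n k l : nat) (f : 'I_n -> 'cV[R]_l -> R) (E : 'I_n -> 'M[R]_(l, k)).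
Hypothesis f2 : forall i, twice_differentiable (f i).
Let F (x : 'cV[R]_k) := \sum_i f i (E i *m x).

Lemma grad_aggregate x : grad F x = \sum_i (E i)^T *m grad (f i) (E i *m x).
Proof.
have -> : F = \sum_i (f i \o mulmx (E i)).
  by apply/funext => y; rewrite fct_sumE.
apply/colP => j; rewrite mxE derive_sum => [|i]; last first.
  apply: diff_derivable; apply: differentiable_comp.
    exact: differentiable_mulmx.
  exact: (f2 i _).1.
rewrite summxE; apply: eq_bigr => i _.
have dE := differentiable_mulmx (E i) x; have [df _] := f2 i (E i *m x).
rewrite deriveE; last exact: differentiable_comp.
rewrite diff_comp //= diff_mulmx diff_dot_grad //.
by rewrite dotC dot_mulmxl dotC dot_delta.
Qed.

Let gradE : grad F = \sum_i (mulmx (E i)^T \o (grad (f i) \o mulmx (E i))).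
Proof. by apply/funext => x; rewrite grad_aggregate fct_sumE. Qed.

Let dfE i x : differentiable (grad (f i) \o mulmx (E i)) x.
Proof.
by apply: differentiable_comp; [exact: differentiable_mulmx|exact: (f2 i _).2].
Qed.

Lemma differentiable_grad_aggregate x : differentiable (grad F) x.
Proof.
rewrite gradE; apply: differentiable_sum => i.
by apply: differentiable_comp => //; exact: differentiable_mulmx.
Qed.

Lemma hess_aggregate x :
  hess F x = \sum_i (E i)^T *m hess (f i) (E i *m x) *m E i.
Proof.
apply: eq_mulmx_cV => d; rewrite -diff_grad_hess; last first.
  exact: differentiable_grad_aggregate.
have dfE' i : differentiable (mulmx (E i)^T \o (grad (f i) \o mulmx (E i))) x.
  by apply: differentiable_comp => //; exact: differentiable_mulmx.
rewrite -deriveE; last exact: differentiable_grad_aggregate.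
rewrite gradE derive_sum => [|i]; last exact: diff_derivable.
rewrite mulmx_suml; apply: eq_bigr => i _; rewrite deriveE //.
rewrite diff_comp //=; last exact: differentiable_mulmx.
rewrite diff_mulmx diff_comp //=; first last.
- exact: (f2 i _).2.
- exact: differentiable_mulmx.
by rewrite diff_mulmx diff_grad_hess ?mulmxA //; exact: (f2 i _).2.
Qed.

Hypothesis E1 : \sum_i (E i)^T *m E i = 1%:M.

Let scalarE (a : R) : a%:M = \sum_i (E i)^T *m a%:M *m E i.
Proof.
rewrite -scalemx1 -E1 scaler_sumr; apply: eq_bigr => i _.
by rewrite mul_mx_scalar scalemxAl.
Qed.

Let psd_sum_congr (A : 'I_n -> 'M[R]_l) : (forall i, psd (A i)) ->
  psd (\sum_i (E i)^T *m A i *m E i).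
Proof.
move=> pA; apply/psdP; split.
  rewrite linear_sum; apply: eq_bigr => i _.
  by rewrite /= !trmx_mul trmxK (psd_sym (pA i)) mulmxA.
move=> x; rewrite mulmx_suml.
rewrite (big_morph (dot x) (dotDr x) (_ : dot x 0 = 0)); last first.
  by rewrite /dot mulmx0 mxE.
apply: sumr_ge0 => i _.
by rewrite -!mulmxA -dot_mulmxl; exact: psd_ge0.
Qed.

(** By [E1], [a I] is itself a sum of congruences, so the difference is the sum of the
    [(E i)^T (hess (f i) - a I) (E i)], each positive semidefinite. *)
Lemma hess_aggregate_ge (a : R) :
  (forall i y, loewner_le a%:M (hess (f i) y)) ->
  forall x, loewner_le a%:M (hess F x).
Proof.
move=> ha x; rewrite /loewner_le hess_aggregate (scalarE a) -sumrB.
under eq_bigr do rewrite -mulmxBl -mulmxBr.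
by apply: psd_sum_congr => i; exact: ha.
Qed.

Lemma hess_aggregate_le (a : R) :
  (forall i y, loewner_le (hess (f i) y) a%:M) ->
  forall x, loewner_le (hess F x) a%:M.
Proof.
move=> ha x; rewrite /loewner_le hess_aggregate (scalarE a) -sumrB.
under eq_bigr do rewrite -mulmxBl -mulmxBr.
by apply: psd_sum_congr => i; exact: ha.
Qed.

End Aggregate.

End Calculus.

(** * The contraction inequality *)

Section Contraction.
Variables (R : realType) (k : nat).
Implicit Types (a b : 'cV[R]_k).

(** Young's inequality: [t - 1] times the gap between the two sides is [|(t - 1) a - b|^2]. *)
Lemma sqnorm_add_le a b (t : R) : 1 < t ->
  dot (a + b) (a + b) <= t * dot a a + t / (t - 1) * dot b b.
Proof.
move=> t1; have t0 : 0 < t - 1 by rewrite subr_gt0.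
rewrite -(ler_pM2l t0) -subr_ge0.
have := dot_ge0 ((t - 1) *: a - b).
rewrite !dot_lin [dot b a]dotC.
congr (is_true (0 <= _)).
by move: (dot a a) (dot a b) (dot b b) => x y z; field; rewrite gt_eqF.
Qed.


(** Here [X] and [V] are the new primal and dual errors and [D] and [dv] the increments, so [X - D]
    and [V - dv] are the old errors. The three entries of the minimum pay for the terms in [|q|^2],
    [|X|^2] and [|D|^2] respectively. *)
Lemma contraction_step (S : 'M[R]_k) (q X V dv D e : 'cV[R]_k)
    (alpha eps m M beta phi zeta Gamma lam : R) :
  S^T = S -> 0 < alpha -> 0 < eps -> 0 < m -> m <= M -> 1 < beta -> 1 < phi ->
  0 < lam -> 0 < zeta -> (m + M) / (2 * m * M) < zeta ->
  zeta < eps / Gamma ^+ 2 ->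
  q + S *m V + eps *: D + e = 0 -> dv = alpha *: (S *m X) ->
  m * M * dot X X + dot q q <= (m + M) * dot X q ->
  lam * dot V V <= dot (S *m V) (S *m V) ->
  dot e e <= Gamma ^+ 2 * dot D D ->
  dot V V + alpha * eps * dot X X
  <= 1 / (1 + esom_delta alpha eps m M beta phi zeta Gamma lam)
     * (dot (V - dv) (V - dv) + alpha * eps * dot (X - D) (X - D)).
Proof.
move=> sS al0 ep0 m0 mM be1 ph1 la0 ze0 ze1 ze2 SV dvE coc hlam he.
have M0 : 0 < M by exact: lt_le_trans m0 mM.
have mM0 : 0 < m + M by exact: addr_gt0.
(* Division by zero yields 0, so [Gamma = 0] would contradict [0 < zeta < eps / Gamma ^+ 2]. *)
have Ga0 : 0 < Gamma ^+ 2.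
  rewrite lt_def sqr_ge0 andbT; apply/eqP => Ga0.
  by have := lt_trans ze0 ze2; rewrite Ga0 invr0 mulr0 ltxx.
have be0 : 0 < beta - 1 by rewrite subr_gt0.
have ph0 : 0 < phi - 1 by rewrite subr_gt0.
have beta0 : 0 < beta by rewrite (lt_trans ltr01).
have phi0 : 0 < phi by rewrite (lt_trans ltr01).
have zeG : zeta * Gamma ^+ 2 < eps by rewrite -ltr_pdivlMr.
pose T := 1 + phi * Gamma ^+ 2 * (beta - 1) / ((phi - 1) * eps ^+ 2).
have T0 : 0 < T.
  by apply: addr_gt0 => //; apply: divr_gt0; repeat (apply: mulr_gt0 => //).
pose d1 := 2 * alpha * lam / (phi * beta * (m + M)).
pose d2 := 2 * m * M / (eps * (m + M)) - 1 / (zeta * eps).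
pose d3 := (beta - 1) * alpha * lam / (beta * eps)
  * (1 - zeta * Gamma ^+ 2 / eps) * T^-1.
have d1_gt0 : 0 < d1 by rewrite divr_gt0 ?mulr_gt0.
(* Positivity of [d2] is the lower bound on [zeta]; that of [d3] below is the upper bound. *)
have d2_gt0 : 0 < d2.
  have -> : d2 = (2 * m * M / (m + M) - zeta^-1) / eps.
    by rewrite /d2; field; rewrite !gt_eqF.
  rewrite divr_gt0 // subr_gt0 -[ltRHS]invf_div ltf_pV2 // posrE.
  by rewrite divr_gt0 // !mulr_gt0.
have d3_gt0 : 0 < d3.
  rewrite !mulr_gt0 ?invr_gt0 ?mulr_gt0 //.
  by rewrite subr_gt0 ltr_pdivrMr // mul1r.
set del := esom_delta _ _ _ _ _ _ _ _ _.
have del0 : 0 < del by rewrite /del /esom_delta !lt_min d1_gt0 d2_gt0 d3_gt0.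
have [del1 del2 del3] : [/\ del <= d1, del <= d2 & del <= d3].
  have : del <= del by [].
  by rewrite {2}/del /esom_delta !le_min => /and3P.
clearbody del.
rewrite mul1r [leRHS]mulrC ler_pdivlMr ?addr_gt0 //.
have SVE : S *m V = - (q + e + eps *: D).
  apply/eqP; rewrite -addr_eq0 -[X in _ == X]SV; apply/eqP.
  rewrite addrC -!addrA; congr (q + _).
  by rewrite [RHS]addrA [RHS]addrC (addrC (S *m V)).
(* Young's inequality with [beta] separates [q + e] from [eps D], then with [phi] separates [q] from
   [e]; [T] gathers the two contributions to [|D|^2]. *)
have hw : lam * dot V V <= phi * beta * dot q q
    + beta / (beta - 1) * eps ^+ 2 * T * dot D D.
  apply: le_trans hlam _; rewrite SVE !dotNl !dotNr opprK.
  apply: (le_trans (sqnorm_add_le _ _ be1)).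
  have h1 := sqnorm_add_le q e ph1.
  have h2 : dot (q + e) (q + e)
      <= phi * dot q q + phi / (phi - 1) * (Gamma ^+ 2 * dot D D).
    by apply: le_trans h1 _; rewrite lerD2l ler_wpM2l // ltW // divr_gt0.
  rewrite !dotZl !dotZr.
  apply: le_trans (lerD (ler_wpM2l (ltW beta0) h2) (lexx _)) _.
  rewrite le_eqVlt /T; apply/orP; left; apply/eqP.
  by move: (dot q q) (dot D D) => x y; field; rewrite !gt_eqF.
have hXe : 0 <= dot X X / zeta + 2 * dot X e + zeta * dot e e.
  have := dot_ge0 (X + zeta *: e); rewrite !dot_lin [dot e X]dotC.
  rewrite -(pmulr_rge0 _ (_ : 0 < zeta^-1)) ?invr_gt0 //.
  congr (is_true (0 <= _)).
  by move: (dot X X) (dot X e) (dot e e) => x y z; field; rewrite gt_eqF.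
have dvV : dot V dv = - alpha * (dot q X + dot e X + eps * dot D X).
  by rewrite dvE dotZr -dot_sym // SVE !dot_lin; ring.
(* The term [2 alpha eps <D, X>] produced by [- 2 <V, dv>] cancels the cross term of the primal
   square. *)
have expand : dot (V - dv) (V - dv) + alpha * eps * dot (X - D) (X - D)
   = dot V V + alpha * eps * dot X X + dot dv dv + alpha * eps * dot D D
     + 2 * alpha * (dot X q + dot X e).
  rewrite !dot_lin [dot dv V]dotC dvV [dot q X]dotC [dot e X]dotC [dot D X]dotC.
  by ring.
rewrite expand.
have := dot_ge0 dv; have := dot_ge0 V; have := dot_ge0 q; have := dot_ge0 X.
have := dot_ge0 D.
move: coc hw hXe he.
move: (dot V V) (dot dv dv) (dot q q) (dot X X) (dot D D) (dot e e)
  (dot X q) (dot X e) => v dd b a d ee xq xe coc hw hXe he d0 a0 b0 v0 dd0.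
(* Each bound on [del] is multiplied by the term it absorbs: the [|q|^2] part of [hw], then
   [alpha eps |X|^2], then the [|D|^2] part of [hw]. *)
have {del1} h1 : del * (phi * beta * b / lam) <= 2 * alpha / (m + M) * b.
  have := ler_wpM2r (_ : 0 <= phi * beta * b / lam) del1.
  rewrite divr_ge0 ?mulr_ge0 ?(ltW phi0) ?(ltW beta0) ?(ltW la0) // => /(_ isT).
  move/le_trans; apply; rewrite le_eqVlt /d1; apply/orP; left; apply/eqP.
  by field; rewrite !gt_eqF.
have {del2} h2 : del * (alpha * eps * a)
    <= 2 * alpha / (m + M) * (m * M * a) - alpha * (a / zeta).
  have := ler_wpM2r (_ : 0 <= alpha * eps * a) del2.
  rewrite !mulr_ge0 ?(ltW al0) ?(ltW ep0) // => /(_ isT).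
  move/le_trans; apply; rewrite le_eqVlt /d2; apply/orP; left; apply/eqP.
  by field; rewrite !gt_eqF.
have {del3} h3 : del * (beta / (beta - 1) * eps ^+ 2 * T * d / lam)
    <= alpha * eps * d - alpha * zeta * (Gamma ^+ 2 * d).
  have := ler_wpM2r (_ : 0 <= beta / (beta - 1) * eps ^+ 2 * T * d / lam) del3.
  rewrite !(divr_ge0, mulr_ge0) ?(ltW beta0) ?(ltW be0) ?(ltW ep0) ?(ltW T0)
    ?(ltW la0) //.
  move=> /(_ isT)/le_trans; apply.
  rewrite le_eqVlt /d3; apply/orP; left; apply/eqP.
  by field; rewrite !gt_eqF.
have h4 : del * v <= del * (phi * beta * b / lam)
    + del * (beta / (beta - 1) * eps ^+ 2 * T * d / lam).
  by rewrite -mulrDr ler_wpM2l ?(ltW del0) // -mulrDl ler_pdivlMr // mulrC.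
(* Cocoercivity supplies the positive multiples of [|X|^2] and [|q|^2] spent in [h1] and [h2]. *)
have h5 : 2 * alpha / (m + M) * (m * M * a + b) <= 2 * alpha * xq.
  rewrite -[leLHS]mulrA ler_wpM2l ?mulr_ge0 ?(ltW al0) //.
  by rewrite [leLHS]mulrC ler_pdivrMr // [leRHS]mulrC.
have h6 := mulr_ge0 (ltW al0) hXe.
have h7 := ler_wpM2l (mulr_ge0 (ltW al0) (ltW ze0)) he.
move: h1 h2 h3 h4 h5 h6 h7; move: (phi * beta * b / lam) => l1.
move: (_ * T * d / lam) (a / zeta) (2 * alpha / (m + M)) => l2 az u.
by clear - dd0; lra.
Qed.

End Contraction.

(** * Truncated Newton steps and stochastic matrices *)

Section NeumannTruncation.
Variables (R : realType) (k : nat).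
Implicit Types A B D : 'M[R]_k.

(** Induction in steps of two: [A ^+ u.+2] is the congruence of [A ^+ u] by [A]. *)
Lemma psd_exp A u : psd A -> psd (A ^+ u).
Proof.
move=> pA; have sA := psd_sym pA.
elim/ltn_ind: u => -[|[|u]] IH; first exact: psd1.
  by rewrite expr1.
have sAu := psd_sym (IH u (ltnW (ltnSn _))).
have -> : A ^+ u.+2 = A *m A ^+ u *m A by rewrite exprSr exprS.
apply/psdP; split; first by rewrite !trmx_mul sAu sA mulmxA.
by move=> x; rewrite -!mulmxA -(dot_sym _ _ sA); exact: psd_ge0 (IH _ _).
Qed.

Lemma enorm_exp_le A (r : R) u z : psd A -> 0 <= r ->
  (forall y, dot y (A *m y) <= r * dot y y) ->
  enorm (A ^+ u *m z) <= r ^+ u * enorm z.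
Proof.
move=> pA r0 hA; elim: u => [|u IH]; first by rewrite !expr0 mul1mx mul1r.
rewrite !exprS -mulmxA -mulrA; apply: le_trans (ler_wpM2l r0 IH).
by apply: enorm_le => //; exact: psd_sqnorm_le.
Qed.

(** The sum is the identity plus positive semidefinite powers, so its form at [z] is at least
    [|z|^2]; Cauchy-Schwarz turns this into a bound on norms. *)
Lemma enorm_geometric_ge A K z : psd A ->
  enorm z <= enorm ((\sum_(u < K.+1) A ^+ u) *m z).
Proof.
move=> pA; have := enorm_ge0 z; rewrite le_eqVlt => /orP[/eqP <-|z0].
  exact: enorm_ge0.
rewrite -(ler_pM2l z0); apply: le_trans (cauchy_schwarz _ _).
rewrite -expr2 sqr_enorm big_ord_recl expr0 mulmxDl mul1mx dotDr lerDl.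
rewrite mulmx_suml (big_morph (dot z) (dotDr z) (_ : dot z 0 = 0)); last first.
  by rewrite /dot mulmx0 mxE.
by apply: sumr_ge0 => i _; apply: psd_ge0; exact: psd_exp.
Qed.

(* With [z = D^{-1/2} g] and [A = D^{-1/2} B D^{-1/2}], the residual of the
   truncated Newton step is [D^{1/2} A^{K+1} z], while
   [D^{1/2} d = - (\sum_(u <= K) A^u) z] dominates [z]. *)
Lemma truncated_newton_residual D B (r c : R) K (g d : 'cV[R]_k) :
  let Dmh := invmx (sqrtmx D) in
  psd D -> D \in unitmx -> psd B -> 0 <= r -> 0 <= c ->
  (forall z, dot z (B *m z) <= r * dot z (D *m z)) ->
  (forall z, dot z (D *m z) <= c * dot z z) ->
  d = - (Dmh *m (\sum_(u < K.+1) (Dmh *m B *m Dmh) ^+ u) *m Dmh *m g) ->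
  enorm (g + (D - B) *m d) <= c * r ^+ K.+1 * enorm d.
Proof.
move=> Dmh pD uD pB r0 c0 hB hD dE.
have [pS SS] := psd_sqrtmx pD; have sS := psd_sym pS.
have uS : sqrtmx D \in unitmx by move: uD; rewrite -{1}SS unitmx_mul andbb.
rewrite /Dmh in dE *; set S := sqrtmx D in pS SS sS uS dE *.
have sSi : (invmx S)^T = invmx S by rewrite trmx_inv sS.
set A := invmx S *m B *m invmx S in dE.
have SA : S *m A *m S = B by rewrite /A !mulmxA mulmxV // mul1mx mulmxKV.
have pA : psd A.
  apply/psdP; split; first by rewrite !trmx_mul sSi (psd_sym pB) mulmxA.
  by move=> x; rewrite -!mulmxA -dot_sym //; exact: psd_ge0.
have hA y : dot y (A *m y) <= r * dot y y.
  rewrite /A -!mulmxA -dot_sym //; apply: le_trans (hB _) _.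
  by rewrite -SS -mulmxA mulKVmx // -dot_sym // mulKVmx.
pose z := invmx S *m g.
pose P : 'M[R]_k := \sum_(u < K.+1) A ^+ u.
have Sd : S *m d = - (P *m z).
  by rewrite dE mulmxN -!mulmxA mulKVmx.
have geom : (1%:M - A) *m P = 1%:M - A ^+ K.+1.
  by have := subrX1 A K.+1; rewrite -opprB -[in RHS]opprB mulNr => /oppr_inj ->.
have -> : g + (D - B) *m d = S *m (A ^+ K.+1 *m z).
  have -> : (D - B) *m d = S *m ((1%:M - A) *m (S *m d)).
    by rewrite -SS -SA mulmxBl mulmxBl mul1mx mulmxBr !mulmxA.
  rewrite Sd !mulmxN (mulmxA _ P) geom mulmxBl mul1mx mulmxBr opprB addrC.
  by rewrite {1}/z mulKVmx // subrK.
have hS y : enorm (S *m y) <= Num.sqrt c * enorm y.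
  apply: enorm_le; first exact: sqrtr_ge0.
  by rewrite sqr_sqrtr // dot_sym // mulmxA SS.
apply: le_trans (hS _) _.
(* One factor [sqrt c] comes from the outer [S] in the residual, the other from [|z| <= |S d|]. *)
have -> : c * r ^+ K.+1 * enorm d
    = Num.sqrt c * (r ^+ K.+1 * (Num.sqrt c * enorm d)).
  by rewrite -{1}(sqr_sqrtr c0); ring.
apply: ler_wpM2l; first exact: sqrtr_ge0.
apply: le_trans (enorm_exp_le _ _ pA r0 hA) _.
apply: ler_wpM2l; first exact: exprn_ge0.
apply: le_trans (enorm_geometric_ge K z pA) _.
have -> : enorm (P *m z) = enorm (S *m d).
  by rewrite Sd enormN.
exact: hS.
Qed.

End NeumannTruncation.

(** * Quadratic forms of symmetric stochastic matrices *)

Section Weights.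
Variable R : realType.

Section StochasticMatrix.
Variables (k : nat) (Z : 'M[R]_k).
Hypotheses (Z0 : forall i j, 0 <= Z i j) (sZ : Z^T = Z).
Hypothesis (Z1 : forall i, \sum_j Z i j = 1).

(** The form of [I + s Z] as a weighted sum of squares over edges: [s = -1] serves the Laplacian
    [I - Z], [s = 1] its signless counterpart. *)
Let sum_sqr (s : R) (x : 'cV[R]_k) : s ^+ 2 = 1 ->
  \sum_i \sum_j Z i j * (x i 0 + s * x j 0) ^+ 2
  = 2 * (dot x x + s * dot x (Z *m x)).
Proof.
move=> s2.
have h1 : dot x x = \sum_i \sum_j Z i j * x i 0 ^+ 2.
  by rewrite dotE; apply: eq_bigr => i _; rewrite -mulr_suml Z1 mul1r expr2.
have h2 : dot x x = \sum_i \sum_j Z i j * x j 0 ^+ 2.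
  rewrite h1 exchange_big; apply: eq_bigr => i _; apply: eq_bigr => j _.
  by rewrite -[in LHS]sZ mxE.
have h3 : dot x (Z *m x) = \sum_i \sum_j Z i j * (x i 0 * x j 0).
  rewrite dotE; apply: eq_bigr => i _; rewrite mxE mulr_sumr.
  by apply: eq_bigr => j _; ring.
rewrite mulrDr mulr2n mulrDl mul1r {1}h1 h2 h3.
rewrite -!big_split /= !mulr_sumr -big_split.
apply: eq_bigr => i _; rewrite /= !mulr_sumr -!big_split /=.
by apply: eq_bigr => j _; rewrite sqrrD exprMn s2; ring.
Qed.

Lemma psd_laplacian : psd (1%:M - Z).
Proof.
apply/psdP; split=> [|x]; first by rewrite linearB /= trmx1 sZ.
rewrite mulmxBl mul1mx dotDr dotNr -(pmulr_rge0 _ (ltr0n R 2)).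
rewrite -[- _]mulN1r -sum_sqr; last by rewrite sqrrN expr1n.
rewrite sumr_ge0 // => i _; apply: sumr_ge0 => j _.
by rewrite mulr_ge0 ?sqr_ge0.
Qed.

Lemma diag_partE (A : 'M[R]_k) (x : 'cV[R]_k) :
  dot x (diag_part A *m x) = \sum_i A i i * x i 0 ^+ 2.
Proof. by rewrite dot_diag; apply: eq_bigr => i _; rewrite mxE expr2. Qed.

(** In the edge sum for [I + Z] the terms [j = i] are [4 Z_ii x_i ^ 2], exactly twice the subtracted
    form of [2 Z_d]; the remaining squares are nonnegative. *)
Lemma psd_signless_laplacian : psd (1%:M - 2 *: diag_part Z + Z).
Proof.
apply/psdP; split=> [|x].
  by rewrite linearD linearB /= linearZ /= trmx1 sZ tr_diag_mx.
rewrite mulmxDl mulmxBl mul1mx -scalemxAl !dot_lin diag_partE.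
rewrite -(pmulr_rge0 _ (ltr0n R 2)) addrAC -[dot x (Z *m x)]mul1r mulrDr.
rewrite -sum_sqr ?expr1n // mulrN subr_ge0 !mulr_sumr; apply: ler_sum => i _.
rewrite (bigD1 i) //= -[leLHS]addr0; apply: lerD.
  by rewrite le_eqVlt; apply/orP; left; apply/eqP; ring.
by apply: sumr_ge0 => j _; rewrite mulr_ge0 ?sqr_ge0.
Qed.

Lemma stochastic_le1 i : Z i i <= 1.
Proof. by rewrite -(Z1 i) (bigD1 i) //= lerDl sumr_ge0. Qed.

End StochasticMatrix.
End Weights.

(** * The ESOM iteration *)

Section EsomResidual.
Variables (R : realType) (k : nat) (Z H : 'M[R]_k) (alpha eps m M c : R).
Hypotheses (Z0 : forall i j, 0 <= Z i j) (sZ : Z^T = Z).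
Hypothesis (Z1 : forall i, \sum_j Z i j = 1).
Hypotheses (al0 : 0 < alpha) (ep0 : 0 < eps) (m0 : 0 < m) (mM : m <= M).
Hypotheses (c1 : c <= 1) (cZ : forall i, c <= Z i i).
Hypotheses (sH : H^T = H) (hm : forall z, m * dot z z <= dot z (H *m z)).
Hypothesis (hM : forall z, dot z (H *m z) <= M * dot z z).

(** Since [D - B = H + eps I + alpha (I - Z)], this is the Neumann truncation bound once
    [0 <= B <= rho D] and [D <= (M + eps + 2 alpha (1 - c)) I] are known. *)
Lemma esom_newton_residual K (g d : 'cV[R]_k) :
  let D := H + eps%:M + (2 * alpha) *: (1%:M - diag_part Z) in
  let B := alpha *: (1%:M - 2 *: diag_part Z + Z) in
  let Dmh := invmx (sqrtmx D) in
  d = - (Dmh *m (\sum_(u < K.+1) (Dmh *m B *m Dmh) ^+ u) *m Dmh *m g) ->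
  enorm (g + H *m d + eps *: d + alpha *: ((1%:M - Z) *m d))
  <= (M + eps + 2 * alpha * (1 - c)) * esom_rho alpha eps m c ^+ K.+1 * enorm d.
Proof.
move=> D B Dmh dE.
pose s (z : 'cV[R]_k) := \sum_i (1 - Z i i) * z i 0 ^+ 2.
have sE z : dot z ((1%:M - diag_part Z) *m z) = s z.
  rewrite mulmxBl mul1mx dotDr dotNr diag_partE dotE -sumrB.
  by apply: eq_bigr => i _; ring.
have s0 z : 0 <= s z.
  apply: sumr_ge0 => i _; rewrite mulr_ge0 ?sqr_ge0 // subr_ge0.
  exact: stochastic_le1.
have s1 z : s z <= (1 - c) * dot z z.
  rewrite dotE mulr_sumr; apply: ler_sum => i _.
  by rewrite -expr2 ler_wpM2r ?sqr_ge0 // lerD2l lerN2.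
have DE z : dot z (D *m z) = dot z (H *m z) + eps * dot z z + 2 * alpha * s z.
  rewrite /D !mulmxDl !dotDr mul_scalar_mx dotZr.
  rewrite -[(2 * alpha) *: _ *m z]scalemxAl.
  by rewrite dotZr sE.
have BE z : dot z (B *m z) = 2 * alpha * s z - alpha * dot z ((1%:M - Z) *m z).
  have -> : B = (2 * alpha) *: (1%:M - diag_part Z) - alpha *: (1%:M - Z).
    by apply/matrixP => i j; rewrite !mxE; ring.
  by rewrite mulmxBl dotDr dotNr -!scalemxAl !dotZr sE.
have meps : 0 < m + eps by rewrite addr_gt0.
have D_ge z : (m + eps) * dot z z <= dot z (D *m z).
  rewrite DE mulrDl -addrA lerD // lerDl.
  by rewrite !mulr_ge0 // ltW.
have pD : psd D.
  apply/psdP; split.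
    have sd : (1%:M - diag_part Z)^T = 1%:M - diag_part Z.
      by rewrite linearB /= trmx1 tr_diag_mx.
    by rewrite /D linearD linearZ /= sd linearD /= tr_scalar_mx sH.
  by move=> z; apply: le_trans (D_ge z); rewrite mulr_ge0 ?dot_ge0 ?ltW.
have pB : psd B.
  have pL := psd_signless_laplacian Z0 sZ Z1.
  apply/psdP; split; first by rewrite linearZ /= (psd_sym pL).
  by move=> z; rewrite -scalemxAl dotZr mulr_ge0 ?(ltW al0) //; exact: psd_ge0.
have a0 : 0 <= 2 * alpha * (1 - c) by rewrite !mulr_ge0 ?subr_ge0 ?(ltW al0).
have den0 : 0 < 2 * alpha * (1 - c) + m + eps by rewrite -addrA ltr_wpDl.
have C0 : 0 <= M + eps + 2 * alpha * (1 - c).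
  by rewrite !addr_ge0 // ?(ltW ep0) // (le_trans (ltW m0)).
have rho0 : 0 <= esom_rho alpha eps m c by rewrite divr_ge0 // ltW.
(* Dropping [- alpha (I - Z)] gives [B <= 2 alpha (I - Z_d)]. As [y / (y + m + eps)] increases with
   [y], the bound [2 alpha (1 - c)] on [2 alpha (I - Z_d)] yields the ratio [rho]. *)
have hB z : dot z (B *m z) <= esom_rho alpha eps m c * dot z (D *m z).
  apply: (@le_trans _ _ (2 * alpha * s z)).
    rewrite BE gerBl mulr_ge0 ?(ltW al0) //.
    exact/psd_ge0/psd_laplacian.
  apply: (@le_trans _ _ (esom_rho alpha eps m c
      * ((m + eps) * dot z z + 2 * alpha * s z))); last first.
    apply: ler_wpM2l => //; rewrite DE lerD2r mulrDl lerD2r; exact: hm.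
  rewrite /esom_rho [leRHS]mulrAC ler_pdivlMr //.
  have h := ler_wpM2l (ltW (mulr_gt0 (mulr_gt0 (ltr0n R 2) al0) meps)) (s1 z).
  by move: (s z) (dot z z) h => y x; lra.
have hD z : dot z (D *m z) <= (M + eps + 2 * alpha * (1 - c)) * dot z z.
  have h := ler_wpM2l (ltW (mulr_gt0 (ltr0n R 2) al0)) (s1 z); rewrite DE.
  by have := hM z; move: (s z) (dot z z) (dot z _) h => y x w; lra.
have uD : D \in unitmx by exact: coercive_unitmx meps D_ge.
have := truncated_newton_residual pD uD pB rho0 C0 hB hD dE.
have -> : D - B = H + eps%:M + alpha *: (1%:M - Z).
  by apply/matrixP => i j; rewrite !mxE; ring.
by rewrite (mulmxDl (H + _)) (mulmxDl H) mul_scalar_mx -scalemxAl !addrA.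
Qed.

End EsomResidual.

(** * Block coordinates and the Kronecker product *)

Section Blocks.
Variables (R : realType) (n p : nat).

Lemma sum_mxtens (V : nmodType) (g : 'I_(n * p) -> V) :
  \sum_l g l = \sum_i \sum_j g (mxtens_index (i, j)).
Proof.
rewrite pair_big /= (reindex (@mxtens_index n p)) /=; last first.
  exists (@mxtens_unindex n p) => ij _; first exact: mxtens_indexK.
  exact: mxtens_unindexK.
by apply: eq_bigr => -[].
Qed.

(** Matrix form of the projection [blk], so that the chain rule for linear maps applies to
    [aggregate]. *)
Definition blkmx (i : 'I_n) : 'M[R]_(p, n * p) :=
  \matrix_(j, l) (l == mxtens_index (i, j))%:R.

Lemma blkE (x : 'cV[R]_(n * p)) i : blk x i = blkmx i *m x.
Proof.
apply/colP => j; rewrite !mxE (bigD1 (mxtens_index (i, j))) //= mxE eqxx mul1r.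
by rewrite big1 ?addr0 // => l /negbTE h; rewrite mxE h mul0r.
Qed.

Lemma sum_blkmx : \sum_i (blkmx i)^T *m blkmx i = 1%:M.
Proof.
apply/matrixP => l l'; rewrite summxE.
transitivity (\sum_q ((l == q)%:R * (l' == q)%:R : R)).
  rewrite sum_mxtens; apply: eq_bigr => i _; rewrite mxE.
  by apply: eq_bigr => j _; rewrite !mxE.
rewrite (bigD1 l) //= eqxx mul1r mxE big1 ?addr0 1?eq_sym // => q /negbTE h.
by rewrite eq_sym h mul0r.
Qed.

Lemma aggregateE (f : 'I_n -> 'cV[R]_p -> R) :
  aggregate f = fun x => \sum_i f i (blkmx i *m x).
Proof. by apply/funext => x; apply: eq_bigr => i _; rewrite blkE. Qed.

Section Weights.
Variable W : 'M[R]_n.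

Lemma ZmxE i j i' j' :
  Zmx p W (mxtens_index (i, j)) (mxtens_index (i', j')) = W i i' * (j == j')%:R.
Proof. by rewrite /Zmx tensmxE mxE. Qed.

Lemma Zmx_diag i j :
  Zmx p W (mxtens_index (i, j)) (mxtens_index (i, j)) = W i i.
Proof. by rewrite ZmxE eqxx mulr1. Qed.

Lemma Zmx_ge0 : (forall i j, 0 <= W i j) -> forall k l, 0 <= Zmx p W k l.
Proof.
move=> W0 k l; case: (mxtens_indexP k) => i j; case: (mxtens_indexP l) => i' j'.
by rewrite ZmxE mulr_ge0 ?ler0n.
Qed.

Lemma tr_Zmx : W^T = W -> (Zmx p W)^T = Zmx p W.
Proof. by move=> sW; rewrite /Zmx trmx_tens sW trmx1. Qed.

Lemma Zmx_row_sum : W *m (const_mx 1 : 'cV[R]_n) = const_mx 1 ->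
  forall k, \sum_l Zmx p W k l = 1.
Proof.
move=> W1 k; case: (mxtens_indexP k) => i j; rewrite sum_mxtens.
transitivity (\sum_i' W i i').
  apply: eq_bigr => i' _; rewrite (bigD1 j) //= ZmxE eqxx mulr1.
  by rewrite big1 ?addr0 // => j' /negbTE h; rewrite ZmxE eq_sym h mulr0.
move/colP: W1 => /(_ i); rewrite !mxE => <-.
by apply: eq_bigr => i' _; rewrite mxE mulr1.
Qed.

End Weights.
End Blocks.

Lemma sqnormG_col_mx (R : realType) (k : nat) (a e : R) (x y z w : 'cV[R]_k) :
  sqnormG (Gmx k a e) (col_mx x y - col_mx z w)
  = dot (x - z) (x - z) + a * e * dot (y - w) (y - w).
Proof.
rewrite opp_col_mx add_col_mx /sqnormG /Gmx tr_col_mx mul_row_block.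
rewrite !mulmx0 mulmx1 addr0 add0r mul_row_col mul_mx_scalar -scalemxAl.
by rewrite mxE [in X in _ + X]mxE.
Qed.

Lemma in_colspace_add (R : realType) (k : nat) (S : 'M[R]_k) (v w : 'cV[R]_k) :
  in_colspace S v -> in_colspace S (v + S *m w).
Proof. by move=> [u ->]; exists (u + w); rewrite mulmxDr. Qed.

Theorem theorem2 (R : realType) (n p : nat) (hn : (2 <= n)%N) (hp : (1 <= p)%N)
    (e : rel 'I_n) (he : connected_graph e)
    (W : 'M[R]_n) (hW : weight_matrix e W)
    (f : 'I_n -> 'cV[R]_p -> R) (m M L : R)
    (hm : 0 < m) (hmM : m <= M)
    (hf2 : forall i : 'I_n, twice_differentiable (f i))
    (hfm : forall (i : 'I_n) (y : 'cV[R]_p), loewner_le m%:M (hess (f i) y))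
    (hfM : forall (i : 'I_n) (y : 'cV[R]_p), loewner_le (hess (f i) y) M%:M)
    (hL : forall y z : 'cV[R]_(n * p),
      opnorm (hess (aggregate f) y - hess (aggregate f) z) <= L * enorm (y - z))
    (alpha eps : R) (halpha : 0 < alpha) (heps : 0 < eps) (K : nat)
    (x v : nat -> 'cV[R]_(n * p))
    (hesom : esom_seq W f alpha eps K x v)
    (hv0 : in_colspace (sqrtmx (1%:M - Zmx p W)) (v 0%N))
    (xs vs : 'cV[R]_(n * p))
    (hxs : primal_solution W f xs)
    (hvs : grad (aggregate f) xs + sqrtmx (1%:M - Zmx p W) *m vs = 0)
    (hvscol : in_colspace (sqrtmx (1%:M - Zmx p W)) vs)
    (c : R) (hc : 0 < c) (hcW : forall i : 'I_n, c <= W i i)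
    (lam : R) (hlam : is_min_nonzero_eigenvalue (1%:M - Zmx p W) lam)
    (beta phi : R) (hbeta : 1 < beta) (hphi : 1 < phi)
    (t : nat) (zeta : R) (hzeta : 0 < zeta)
    (hzeta1 : (m + M) / (2 * m * M) < zeta)
    (hzeta2 : zeta < eps / esom_Gamma alpha eps m M L c K (x t) (x t.+1) ^+ 2) :
  sqnormG (Gmx (n * p) alpha eps) (col_mx (v t.+1) (x t.+1) - col_mx vs xs)
  <= 1 / (1 + esom_delta alpha eps m M beta phi zeta
                (esom_Gamma alpha eps m M L c K (x t) (x t.+1)) lam)
     * sqnormG (Gmx (n * p) alpha eps) (col_mx (v t) (x t) - col_mx vs xs).
Proof.
have [W0 _ sW W1 _] := hW.
have Z0 := @Zmx_ge0 R n p W W0; have sZ := tr_Zmx p sW.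
have Z1 := @Zmx_row_sum R n p W W1.
have pL := psd_laplacian Z0 sZ Z1.
have [pS SS] := psd_sqrtmx pL; have sS := psd_sym pS.
have vcol s : in_colspace (sqrtmx (1%:M - Zmx p W)) (v s).
  elim: s => // s IH; have [_ ->] := hesom s.
  by rewrite scalemxAr; exact: in_colspace_add.
have dF y : differentiable (grad (aggregate f)) y.
  by rewrite aggregateE; exact: differentiable_grad_aggregate.
have mF y : loewner_le m%:M (hess (aggregate f) y).
  by rewrite aggregateE; apply: hess_aggregate_ge => //; exact: sum_blkmx.
have MF y : loewner_le (hess (aggregate f) y) M%:M.
  by rewrite aggregateE; apply: hess_aggregate_le => //; exact: sum_blkmx.
(* The operator norm hypothesis is made pointwise; the Hessian bounds provide the boundedness that
   [opnorm_ge] requires. *)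
have LF y z u : enorm ((hess (aggregate f) y - hess (aggregate f) z) *m u)
    <= L * enorm (y - z) * enorm u.
  have M0 : 0 <= 2 * M by rewrite mulr_ge0 // (le_trans (ltW hm)).
  apply: le_trans (opnorm_ge M0 _ u) _.
    by move=> w; exact: (enorm_hess_sub_le hm hmM mF MF).
  by apply: ler_wpM2r (hL y z); exact: enorm_ge0.
have lam0 : 0 < lam.
  have [elam lamn0 _] := hlam.
  by rewrite lt_def lamn0; exact: psd_eigenvalue_ge0 pL elam.
have c1 : c <= 1.
  have i0 : 'I_n by exact: Ordinal (ltnW hn).
  have j0 : 'I_p by exact: Ordinal hp.
  apply: le_trans (hcW i0) _; rewrite -(Zmx_diag W i0 j0).
  exact: stochastic_le1.
have cZ k : c <= Zmx p W k k.
  by case: (mxtens_indexP k) => i j; rewrite Zmx_diag.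
have [xE vE] := hesom t.
set d := x t.+1 - x t.
have xd : x t + d = x t.+1 by rewrite addrC subrK.
set g := grad (aggregate f) (x t) + sqrtmx (1%:M - Zmx p W) *m v t
  + alpha *: ((1%:M - Zmx p W) *m x t) in xE.
have dE : d = - (esomHinv W f alpha eps K (x t) *m g).
  by rewrite /d xE addrAC subrr add0r.
have res := esom_newton_residual Z0 sZ Z1 halpha heps hm hmM c1 cZ
  (hess_sym mF (x t)) (hess_ge mF (x t)) (hess_le MF (x t)) dE.
set Gam := esom_Gamma _ _ _ _ _ _ _ _ _.
set r := (X in enorm X) in res.
set e1 := grad (aggregate f) (x t.+1) - grad (aggregate f) (x t)
  - hess (aggregate f) (x t) *m d.
have e1_le : enorm e1 <= Num.min (2 * M) (L / 2 * enorm d) * enorm d.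
  have h1 := taylor_grad_le dF hm hmM mF MF (x t) d.
  have h2 := taylor_grad_lipschitz dF (x t) d LF.
  rewrite xd -/e1 in h1 h2; rewrite expr2 mulrA in h2.
  by rewrite /Num.min; case: ifP.
(* Minus the Taylor remainder and the Newton residual: with this choice the inexact proximal
   equation [opt] holds exactly. *)
set ee := - e1 - r.
have ee_le : enorm ee <= Gam * enorm d.
  apply: le_trans (enorm_triangle _ _) _; rewrite !enormN.
  by rewrite /Gam /esom_Gamma -/d mulrDl lerD.
(* All matrix products become opaque vectors, leaving an identity that is linear in each
   coordinate. *)
have arith (G0 G1 Gs Sv Sv1 Svs Hd ed Lx Ld : 'cV[R]_(n * p)) :
    Gs + Svs = 0 -> Sv1 = Sv + (Lx + Ld) ->
    G1 - Gs + (Sv1 - Svs) + ed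
      + (- (G1 - G0 - Hd) - (G0 + Sv + Lx + Hd + ed + Ld)) = 0.
  move=> h ->; apply/colP => i; move/colP: h => /(_ i); rewrite !mxE => h; lra.
(* Applying [S] to the dual update yields [alpha (I - Z) x_{t+1}], split along [x_t + d] to match
   the penalty terms of [g] and of the residual. *)
have hSv1 : sqrtmx (1%:M - Zmx p W) *m v t.+1
    = sqrtmx (1%:M - Zmx p W) *m v t
      + (alpha *: ((1%:M - Zmx p W) *m x t) + alpha *: ((1%:M - Zmx p W) *m d)).
  by rewrite vE mulmxDr -scalemxAr mulmxA SS -scalerDr -mulmxDr xd.
have opt := arith
  (grad (aggregate f) (x t)) (grad (aggregate f) (x t.+1)) _ _ _ _
  (hess (aggregate f) (x t) *m d) (eps *: d) _ _ hvs hSv1.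
rewrite -mulmxBr in opt.
(* Feasibility [S xs = 0] allows the iterate to be replaced by its error. *)
have dvE : v t.+1 - v t = alpha *: (sqrtmx (1%:M - Zmx p W) *m (x t.+1 - xs)).
  by have [Sxs _] := hxs; rewrite mulmxBr Sxs subr0 vE addrAC subrr add0r.
have xsd : xs + (x t.+1 - xs) = x t.+1 by rewrite addrC subrK.
have coc := cocoercive dF hmM mF MF (y := xs) (d := x t.+1 - xs) erefl.
rewrite xsd in coc.
have Vcol : in_colspace (sqrtmx (1%:M - Zmx p W)) (v t.+1 - vs).
  have [a ->] := vcol t.+1; have [b ->] := hvscol.
  by exists (a - b); rewrite mulmxBr.
have Vlam := sqrt_colspace_bound pS SS hlam Vcol.
have hee : dot ee ee <= Gam ^+ 2 * dot d d.
  rewrite -!sqr_enorm -exprMn ler_sqr ?nnegrE ?enorm_ge0 //.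
  exact: le_trans (enorm_ge0 _) ee_le.
have := contraction_step sS halpha heps hm hmM hbeta hphi lam0 hzeta hzeta1
  hzeta2 opt dvE coc Vlam hee.
rewrite !sqnormG_col_mx.
have -> : v t.+1 - vs - (v t.+1 - v t) = v t - vs.
  by rewrite opprB addrC addrA subrK.
have -> // : x t.+1 - xs - d = x t - xs.
by rewrite opprB addrC addrA subrK.
Qed.
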